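(* For all integers $k \geq 2$ and $d \geq 2$, $$\gamma_d(k) \leq \frac{2}{k}.$$
   Context: A closed curve $C$ in $\mathbb{R}^d$ is a rectifiable closed curve of positive finite length, denoted $w(C)$. It is identified with its arc-length parameterization $r\colon \mathbb{R}/w(C)\mathbb{Z} \to \mathbb{R}^d$; subsets and partitions of $C$ mean subsets and partitions of the parameter circle $\mathbb{R}/w(C)\mathbb{Z}$ (for a simple closed curve this is the same as subsets and partitions of the point set of $C$). For a non-empty subset $S$ of $C$, $w(S)$ denotes the minimum length of a closed curve in $\mathbb{R}^d$ (a single point being allowed, with length $0$) whose image contains $S$, that is, contains $r(S)$. $P_k(C)$ denotes the set of all partitions of $C$ into $k$ non-empty (not necessarily connected) sets. Define $$\gamma(C,k) = \min_{\mathcal{S}\in P_k(C)} \frac{\max_{S\in\mathcal{S}} w(S)}{w(C)}, \qquad \gamma_d(k) = \sup_{C \text{ in } \mathbb{R}^d} \gamma(C,k),$$ where the supremum is over all closed curves $C$ in $\mathbb{R}^d$. *)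

(* Defs.v *)
From HB Require Import structures.
From mathcomp Require Import all_boot all_order all_algebra.
From mathcomp Require Import all_classical all_reals all_analysis.

Set Implicit Arguments.
Unset Strict Implicit.
Unset Printing Implicit Defensive.

Import Order.TTheory GRing.Theory Num.Theory.

Local Open Scope classical_set_scope.
Local Open Scope ring_scope.

(* The canonical norm on ['rV[R]_d] is the sup norm, hence this definition. *)
Definition enorm (R : realType) (d : nat) (v : 'rV[R]_d) : R :=
  Num.sqrt (\sum_(i < d) v 0 i ^+ 2).

Definition polygon_length (R : realType) (d : nat) (r : R -> 'rV[R]_d)
    (a b : R) (s : seq R) : R :=
  \sum_(0 <= i < size s)
    enorm (r (nth b (a :: s) i.+1) - r (nth b (a :: s) i)).

Definition arc_length (R : realType) (d : nat) (r : R -> 'rV[R]_d) (a b : R) :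
    \bar R :=
  ereal_sup [set (polygon_length r a b s)%:E | s in itv_partition a b].

(* A rectifiable closed curve of positive finite length L, in its arc-length
   parameterization: a map on the circle R/LZ is an L-periodic map on R.
   Continuity follows from [curve_arc_length], which makes the map
   1-Lipschitz. *)
Record closed_curve (R : realType) (d : nat) := ClosedCurve {
  curve_length : R;
  curve_fun :> R -> 'rV[R]_d;
  curve_length_gt0 : 0 < curve_length;
  curve_periodic : forall t, curve_fun (t + curve_length) = curve_fun t;
  curve_arc_length :
    forall a b, a <= b -> arc_length curve_fun a b = (b - a)%:E }.

(* Every point of the circle R/LZ has a unique representative in [0, L[, so
   that subsets and partitions of the circle are those of [0, L[. *)
Definition circle (R : realType) (d : nat) (C : closed_curve R d) : set R :=
  `[0, curve_length C[.

(* Least length of a closed curve, possibly a single point, whose image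
   contains X.  For nonempty bounded X the minimum is attained
   (Arzela-Ascoli), so it is the infimum. *)
Definition tour_length (R : realType) (d : nat) (X : set 'rV[R]_d) : \bar R :=
  ereal_inf ([set (curve_length C)%:E |
                C in [set C : closed_curve R d | X `<=` range C]]
             `|` [set 0%E | p in [set p : 'rV[R]_d | X `<=` [set p]]]).

Definition subset_length (R : realType) (d : nat) (C : closed_curve R d)
    (S : set R) : \bar R :=
  tour_length (C @` S).

(* The minimum over partitions is attained, again by compactness, so it is
   the infimum; [partition] requires every part to be nonempty. *)
Definition gamma_curve (R : realType) (d : nat) (C : closed_curve R d)
    (k : nat) : \bar R :=
  ereal_inf [set ((\big[maxe/-oo]_(i < k) subset_length C (S i))
                  / (curve_length C)%:E)%E |
               S in [set S : 'I_k -> set R |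
                      partition [set: 'I_k] S (circle C)]].

Definition gamma (R : realType) (d k : nat) : \bar R :=
  ereal_sup [set gamma_curve C k | C in [set: closed_curve R d]].

(* Main.v *)
Require Import Defs.
From HB Require Import structures.
From mathcomp Require Import all_boot all_order all_algebra.
From mathcomp Require Import all_classical all_reals all_analysis.
From mathcomp Require Import ring lra.

(** Let [C] have length [L]. Cut its parameter circle into [k] consecutive arcs
    of length [l = L / k]. Walking along such an arc and then back along the
    same arc is a closed curve of length [2 l] that contains the arc, hence each
    part of this partition has a tour of length at most [2 L / k], and dividing
    by [L] gives the ratio [2 / k] for every curve.

    What has to be checked is that the there-and-back walk
    [t |-> C (a + zigzag l t)], where [zigzag l t] is the distance from [t] to
    the nearest multiple of [2 l], is parameterized by arc length on every
    segment ([zigzag_arc_length]).  It does not go faster than unit speed,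
    because [C] and [zigzag l] are both 1-Lipschitz.  It does not go slower,
    because on each segment between two consecutive turning points it is a
    translate or a reversed translate of [C], whose arc length is known
    ([arc_length_shift_le], [arc_length_reverse_le]), and because lower bounds
    on arc length add up over adjacent segments ([arc_length_ge_cat]).  The
    passage from single pieces to arbitrary segments is [itv_glue]. *)

Set Implicit Arguments.
Unset Strict Implicit.
Unset Printing Implicit Defensive.

Import Order.TTheory GRing.Theory Num.Theory.

Local Open Scope classical_set_scope.
Local Open Scope ring_scope.

(** * Lengths of inscribed polygons *)

Lemma enorm0 (R : realType) (d : nat) : enorm (0 : 'rV[R]_d) = 0.
Proof.
by rewrite /enorm big1 ?sqrtr0// => i _; rewrite mxE expr0n.
Qed.

Lemma enormN (R : realType) (d : nat) (v : 'rV[R]_d) : enorm (- v) = enorm v.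
Proof.
by rewrite /enorm; congr Num.sqrt; apply: eq_bigr => i _; rewrite mxE sqrrN.
Qed.

Lemma polygon_length_nil (R : realType) (d : nat) (r : R -> 'rV[R]_d)
  (a b : R) : polygon_length r a b [::] = 0.
Proof. by rewrite /polygon_length big_nil. Qed.

Lemma polygon_length_cons (R : realType) (d : nat) (r : R -> 'rV[R]_d)
    (a b x : R) (s : seq R) :
  polygon_length r a b (x :: s) =
  enorm (r x - r a) + polygon_length r x b s.
Proof. by rewrite /polygon_length /= big_nat_recl. Qed.

Lemma polygon_length_default (R : realType) (d : nat) (r : R -> 'rV[R]_d)
    (a b c : R) (s : seq R) : polygon_length r a b s = polygon_length r a c s.
Proof.
elim: s a => [|x s IH] a; first by rewrite !polygon_length_nil.
by rewrite !polygon_length_cons IH.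
Qed.

Lemma polygon_length_cat (R : realType) (d : nat) (r : R -> 'rV[R]_d)
    (a b : R) (s t : seq R) :
  polygon_length r a b (s ++ t) =
  polygon_length r a b s + polygon_length r (last a s) b t.
Proof.
elim: s a => [|x s IH] a /=; first by rewrite polygon_length_nil add0r.
by rewrite !polygon_length_cons IH addrA.
Qed.

Lemma polygon_length_map (R : realType) (d : nat) (r : R -> 'rV[R]_d)
    (f : R -> R) (a b : R) (s : seq R) :
  polygon_length r (f a) (f b) (map f s) = polygon_length (r \o f) a b s.
Proof.
elim: s a => [|x s IH] a /=; first by rewrite !polygon_length_nil.
by rewrite !polygon_length_cons IH.
Qed.

Lemma eq_in_polygon_length (R : realType) (d : nat) (r r' : R -> 'rV[R]_d)
    (a b : R) (s : seq R) :
  {in a :: s, r =1 r'} -> polygon_length r a b s = polygon_length r' a b s.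
Proof.
elim: s a => [|x s IH] a rr'; first by rewrite !polygon_length_nil.
rewrite !polygon_length_cons IH; last first.
  by move=> t ts; apply: rr'; rewrite inE ts orbT.
by rewrite !rr'// !inE eqxx ?orbT.
Qed.

(** The vertices [a :: s] in reverse order are [last a s] followed by
    [rev (belast a s)]. *)
Lemma polygon_length_rev (R : realType) (d : nat) (r : R -> 'rV[R]_d)
    (a b : R) (s : seq R) :
  polygon_length r (last a s) b (rev (belast a s)) = polygon_length r a b s.
Proof.
elim: s a => [|x s IH] a /=; first by rewrite !polygon_length_nil.
rewrite rev_cons -cats1 polygon_length_cat IH polygon_length_cons.
rewrite polygon_length_nil addr0 polygon_length_cons addrC -enormN opprB.
congr (enorm (_ - r _) + _).
by case: s {IH} => [|y s] //=; rewrite rev_cons last_rcons.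
Qed.

(** * Arc length under change of parameter *)

Lemma itv_partition_sub_itv (R : realType) (a b : R) (s : seq R) :
  itv_partition a b s -> {in a :: s, forall t, t \in `[a, b]}.
Proof.
move=> abs t /(nthP b)[i]; rewrite /= ltnS => si <-.
by rewrite in_itv/= itv_partition_nth_ge// itv_partition_nth_le.
Qed.

Lemma polygon_length_le_arc_length (R : realType) (d : nat)
    (r : R -> 'rV[R]_d) (a b : R) (s : seq R) :
  itv_partition a b s -> ((polygon_length r a b s)%:E <= arc_length r a b)%E.
Proof. by move=> abs; apply: ereal_sup_ubound; exists s. Qed.

(** Inscribed polygons of [r] translate to inscribed polygons of [r'].  Asking
    for [r' t = r (t + c)] on the segment only lets this apply to one piece of a
    piecewise defined [r'].  Only the inequality is stated, since upper bounds
    on arc length come from the Lipschitz property. *)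
Lemma arc_length_shift_le (R : realType) (d : nat) (r r' : R -> 'rV[R]_d)
    (c x y : R) :
  {in `[x, y], forall t, r' t = r (t + c)} ->
  (arc_length r (x + c) (y + c) <= arc_length r' x y)%E.
Proof.
move=> r'E; apply: ge_ereal_sup => _ [s xys <-].
pose f t := t - c; set s' := map f s.
have xys' : itv_partition x y s'.
  have -> : x = f (x + c) by rewrite /f addrK.
  case: xys => ps /eqP ls; split; last by rewrite last_map ls /f addrK.
  rewrite path_map.
  by apply: sub_path ps => u v /=; rewrite /f ltrD2r.
suff -> : polygon_length r (x + c) (y + c) s = polygon_length r' x y s'.
  exact: polygon_length_le_arc_length.
rewrite (@eq_in_polygon_length _ _ r' (r \o +%R^~ c)); last first.
  by move=> t /(itv_partition_sub_itv xys')/r'E.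
rewrite -[RHS]polygon_length_map /s' -map_comp; congr polygon_length.
by rewrite (eq_map (g := id)) ?map_id// => t /=; rewrite /f subrK.
Qed.

Lemma arc_length_opp_le (R : realType) (d : nat) (r : R -> 'rV[R]_d) (x y : R) :
  (arc_length r (- y) (- x) <= arc_length (r \o -%R) x y)%E.
Proof.
apply: ge_ereal_sup => _ [s xys <-].
have := itv_partition_rev xys; rewrite !opprK => xys'.
apply: le_trans (polygon_length_le_arc_length _ xys').
have {2}-> : x = last y (map -%R s).
  by case: xys => _ /eqP ls; rewrite -[y]opprK last_map ls opprK.
rewrite polygon_length_rev lee_fin -[leRHS]polygon_length_map.
rewrite -map_comp (eq_map (g := id)) ?map_id; last first.
  by move=> t /=; rewrite opprK.
by rewrite (polygon_length_default _ _ _ (- x)).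
Qed.

(** Combines the reflection [t |-> - t] with a shift by [- c]. *)
Lemma arc_length_reverse_le (R : realType) (d : nat) (r r' : R -> 'rV[R]_d)
    (c x y : R) :
  {in `[x, y], forall t, r' t = r (c - t)} ->
  (arc_length r (c - y) (c - x) <= arc_length r' x y)%E.
Proof.
move=> r'E; rewrite -[c - y]opprB -[c - x]opprB.
apply: le_trans (arc_length_opp_le r _ _) _.
by apply: arc_length_shift_le => t /r'E ->; rewrite /= opprB.
Qed.

(** Partitions of adjacent segments concatenate, so arc length is
    superadditive; the case of a lower bound by the parameter length avoids
    adding extended reals. *)
Lemma arc_length_ge_cat (R : realType) (d : nat) (r : R -> 'rV[R]_d)
    (x y z : R) :
  ((y - x)%:E <= arc_length r x y)%E -> ((z - y)%:E <= arc_length r y z)%E ->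
  ((z - x)%:E <= arc_length r x z)%E.
Proof.
move=> xy yz; apply/lee_subgt0Pr => e e0.
have e2 : 0 < e / 2 by rewrite divr_gt0.
have /ereal_sup_gt[_ [s xys <-]] : ((y - x - e / 2)%:E < arc_length r x y)%E.
  by apply: lt_le_trans xy; rewrite lte_fin ltrBlDr ltrDl.
have /ereal_sup_gt[_ [t yzt <-]] : ((z - y - e / 2)%:E < arc_length r y z)%E.
  by apply: lt_le_trans yz; rewrite lte_fin ltrBlDr ltrDl.
rewrite !lte_fin => lt_t lt_s.
apply: le_trans (polygon_length_le_arc_length r (itv_partition_cat xys yzt)).
rewrite -EFinB lee_fin polygon_length_cat.
have [_ /eqP ->] := xys.
by rewrite (polygon_length_default r x z y); lra.
Qed.

(** Each edge is at most the difference of its parameters, and these differences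
    telescope. *)
Lemma polygon_length_le_lipschitz (R : realType) (d : nat)
    (r : R -> 'rV[R]_d) (a b : R) (s : seq R) :
  (forall x y, x <= y -> enorm (r y - r x) <= y - x) ->
  itv_partition a b s -> polygon_length r a b s <= b - a.
Proof.
move=> rlip; elim: s a => [|x s IH] a abs.
  by rewrite polygon_length_nil (itv_partition_nil abs) subrr.
have ax : a <= x by case: abs => /= /andP[/ltW].
rewrite polygon_length_cons.
by have := IH _ (itv_partition_cons abs); have := rlip _ _ ax; lra.
Qed.

(** A chord is an inscribed polygon with one edge, hence at most the arc
    length. *)
Lemma enorm_closed_curve_le (R : realType) (d : nat) (C : closed_curve R d)
    (x y : R) : enorm (C y - C x) <= `|y - x|.
Proof.
wlog xy : x y / x < y.
  move=> H; have [xy|yx|->] := ltgtP x y.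
  - exact: H.
  - by rewrite -enormN opprB distrC; exact: H.
  by rewrite subrr enorm0.
rewrite gtr0_norm ?subr_gt0// -lee_fin -(curve_arc_length C (ltW xy)).
have := polygon_length_le_arc_length C (itv_partition1 xy).
by rewrite polygon_length_cons polygon_length_nil addr0.
Qed.

(** * The zigzag function *)

(** A property of segments that is stable under concatenation holds for all
    segments as soon as it holds inside each cell [[m h, (m + 1) h]]: cut the
    given segment at the finitely many multiples of [h] in it. *)
Lemma itv_glue (R : realType) (h : R) (Q : R -> R -> Prop) : 0 < h ->
  (forall x y z, x <= y -> y <= z -> Q x y -> Q y z -> Q x z) ->
  (forall (m : int) x y,
     m%:~R * h <= x -> x <= y -> y <= (m + 1)%:~R * h -> Q x y) ->
  forall x y, x <= y -> Q x y.
Proof.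
move=> h0 Qcat Qloc.
(* Induction on the number [n] of further cells in which [y] may lie, [m] being
   the cell of [x]; [x] moves to the right end of its cell at each step. *)
have Qn n : forall (m : int) x y, m%:~R * h <= x -> x <= (m + 1)%:~R * h ->
    x <= y -> y <= (m + 1 + n%:Z)%:~R * h -> Q x y.
  elim: n => [|n IH] m x y mx xm xy ym.
    by apply: Qloc mx xy _; rewrite -[m + 1]addr0.
  set z := (m + 1)%:~R * h.
  have [yz|zy] := leP y z; first exact: Qloc mx xy yz.
  apply: (Qcat _ z) => //; first exact: ltW.
    exact: Qloc mx xm _.
  apply: (IH (m + 1)); rewrite ?(ltW zy)//.
    by rewrite ler_pM2r// ler_int lerDl.
  by rewrite -(addrA (m + 1)) -PoszD add1n.
move=> x y xy.
have hx := floor_itv (x / h); set m := Num.floor (x / h) in hx.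
have {hx} [mx xm] : m%:~R * h <= x /\ x <= (m + 1)%:~R * h.
  by case/andP: hx; rewrite ler_pdivlMr// => -> /ltW; rewrite ler_pdivrMr.
apply: (Qn (Num.truncn (y / h - (m + 1)%:~R)).+1 m x y) => //.
rewrite -ler_pdivrMr// intrD addrC -lerBlDr.
exact/ltW/truncnS_gt.
Qed.

(** The distance from [t] to the nearest multiple of [2 l]: a triangular wave
    that rises with slope [1] on [[0, l]] and falls with slope [-1] on
    [[l, 2 l]]. *)
Definition zigzag (R : realType) (l t : R) : R :=
  l - `|t - (Num.floor (t / (2 * l)))%:~R * (2 * l) - l|.

(** Both end points of the period are included, although the floor jumps at the
    right one: the wave vanishes there on either side.  Closed pieces are what
    gluing requires. *)
Lemma zigzagE (R : realType) (l : R) (m : int) (t : R) : 0 < l ->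
  m%:~R * (2 * l) <= t -> t <= (m + 1)%:~R * (2 * l) ->
  zigzag l t = l - `|t - m%:~R * (2 * l) - l|.
Proof.
move=> l0 mt; rewrite le_eqVlt => /orP[/eqP ->|tm].
  rewrite /zigzag mulfK ?mulf_neq0// ?gt_eqF// intrKfloor intrD mulrDl mul1r.
  rewrite subrr.
  have -> : m%:~R * (2 * l) + 2 * l - m%:~R * (2 * l) - l = l by ring.
  by rewrite sub0r normrN.
rewrite /zigzag (@floor_def _ _ m)// ler_pdivlMr ?mulr_gt0// mt/=.
by rewrite ltr_pdivrMr ?mulr_gt0.
Qed.

Lemma zigzag_periodic (R : realType) (l t : R) : 0 < l ->
  zigzag l (t + 2 * l) = zigzag l t.
Proof.
move=> l0; rewrite /zigzag (mulrDl t) divff ?mulf_neq0// ?gt_eqF//.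
rewrite floorDrz ?rpred1// floor1 intrD mulrDl mul1r.
by congr (_ - `|_|); ring.
Qed.

Lemma zigzag_id (R : realType) (l t : R) : 0 <= t -> t < l -> zigzag l t = t.
Proof.
move=> t0 tl; have l0 := le_lt_trans t0 tl.
rewrite (@zigzagE _ l 0)// ?add0r ?mul0r ?mul1r//; last by lra.
rewrite subr0 ler0_norm; lra.
Qed.

(** On one period this is the reverse triangle inequality, and the triangle
    inequality glues the periods. *)
Lemma zigzag_lipschitz (R : realType) (l x y : R) : 0 < l -> x <= y ->
  `|zigzag l y - zigzag l x| <= y - x.
Proof.
move=> l0; move: x y; apply: (@itv_glue _ (2 * l)); first by rewrite mulr_gt0.
  move=> x y z xy yz Qxy Qyz; apply: le_trans (ler_distD (zigzag l y) _ _) _.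
  by lra.
move=> m x y mx xy ym.
rewrite !(@zigzagE _ l m)//; [|exact: le_trans ym|exact: le_trans xy].
rewrite -[leRHS]ger0_norm ?subr_ge0//.
set u := y - _ - l; set v := x - _ - l.
rewrite [_ - _](_ : _ = `|v| - `|u|); last by ring.
apply: le_trans (ler_dist_dist _ _) _.
by rewrite (_ : v - u = - (y - x)) ?normrN// /u /v; ring.
Qed.

(** * Traversing an arc there and back *)

(** The upper bound is the Lipschitz property.  For the lower bound, inside one
    period the walk follows [C] forwards up to the turning point [c] and
    backwards after it. *)
Lemma zigzag_arc_length (R : realType) (d : nat) (C : closed_curve R d)
    (a l : R) : 0 < l -> forall x y, x <= y ->
  arc_length (fun t => C (a + zigzag l t)) x y = (y - x)%:E.
Proof.
move=> l0; set D := fun t => _.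
have l20 : 0 < 2 * l by rewrite mulr_gt0.
move=> x y xy; apply/eqP; rewrite eq_le; apply/andP; split.
  apply: ge_ereal_sup => _ [s xys <-]; rewrite lee_fin.
  apply: polygon_length_le_lipschitz xys => u v uv.
  apply: le_trans (enorm_closed_curve_le C _ _) _.
  rewrite [X in `|X|](_ : _ = zigzag l v - zigzag l u); last by ring.
  exact: zigzag_lipschitz.
move: x y xy; apply: (itv_glue l20) => [x y z _ _|m x y mx xy ym].
  exact: arc_length_ge_cat.
set c := m%:~R * (2 * l) + l.
have Dl t : x <= t -> t <= y -> zigzag l t = l - `|t - c|.
  move=> xt ty; rewrite (@zigzagE _ l m) ?(le_trans mx)// ?(le_trans ty)//.
  by rewrite /c opprD addrA.
have up u v : x <= u -> u <= v -> v <= y -> v <= c ->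
    ((v - u)%:E <= arc_length D u v)%E.
  move=> xu uv vy vc.
  have -> : v - u = (v + (a + l - c)) - (u + (a + l - c)) by ring.
  rewrite -(curve_arc_length C); last by rewrite lerD2r.
  apply: arc_length_shift_le => t; rewrite in_itv/= => /andP[ut tv].
  rewrite /D Dl ?(le_trans xu)// ?(le_trans tv)//.
  rewrite ler0_norm; last by rewrite subr_le0 (le_trans tv).
  by congr (C _); ring.
have down u v : x <= u -> u <= v -> v <= y -> c <= u ->
    ((v - u)%:E <= arc_length D u v)%E.
  move=> xu uv vy cu.
  have -> : v - u = ((a + l + c) - u) - ((a + l + c) - v) by ring.
  rewrite -(curve_arc_length C); last by rewrite lerB.
  apply: arc_length_reverse_le => t; rewrite in_itv/= => /andP[ut tv].
  rewrite /D Dl ?(le_trans xu)// ?(le_trans tv)//.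
  rewrite ger0_norm; last by rewrite subr_ge0 (le_trans cu).
  by congr (C _); ring.
have [yc|cy] := leP y c; first exact: up.
have [cx|xc] := leP c x; first exact: down.
apply: (@arc_length_ge_cat _ _ _ _ c).
  by apply: up => //; exact: ltW.
by apply: down => //; exact: ltW.
Qed.

Lemma zigzag_curve_periodic (R : realType) (d : nat) (C : closed_curve R d)
    (a l : R) : 0 < l -> forall t,
  C (a + zigzag l (t + 2 * l)) = C (a + zigzag l t).
Proof. by move=> l0 t; rewrite zigzag_periodic. Qed.

Definition there_and_back (R : realType) (d : nat) (C : closed_curve R d)
    (a l : R) (l0 : 0 < l) : closed_curve R d :=
  ClosedCurve (mulr_gt0 (ltr0n R 2) l0)
    (zigzag_curve_periodic C a l0) (zigzag_arc_length C a l0).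

(** The outward half of the there-and-back walk already covers the arc. *)
Lemma subset_length_arc_le (R : realType) (d : nat) (C : closed_curve R d)
    (a l : R) : 0 < l ->
  (subset_length C `[a, (a + l)%R[ <= (2 * l)%:E)%E.
Proof.
move=> l0; apply: ereal_inf_lbound; left.
exists (there_and_back C a l0) => //= _ [t /= + <-].
rewrite in_itv/= => /andP[at_ tl].
exists (t - a) => //=; rewrite zigzag_id ?subr_ge0 ?ltrBlDl//.
by rewrite addrC subrK.
Qed.

(** * Cutting the circle into equal arcs *)

Lemma partition_equal_arcs (R : realType) (L : R) (k : nat) :
  0 < L -> (0 < k)%N ->
  partition [set: 'I_k]
    (fun i : 'I_k =>
       `[i%:R * (L / k%:R), (i%:R * (L / k%:R) + L / k%:R)[%classic)
    (`[0, L[%classic : set R).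
Proof.
move=> L0 k0; set l := L / k%:R.
have l0 : 0 < l by rewrite divr_gt0// ltr0n.
have kl : k%:R * l = L by rewrite mulrC divfK// pnatr_eq0 -lt0n.
have arcE (i : nat) : i%:R * l + l = i.+1%:R * l.
  by rewrite -natr1 mulrDl mul1r.
split.
- apply/seteqP; split => t /=.
    move=> [i _] /=; rewrite !in_itv/= arcE// => /andP[it ti].
    rewrite (le_trans _ it) ?mulr_ge0// ?ltW//=.
    by apply: lt_le_trans ti _; rewrite -kl ler_pM2r// ler_nat.
  rewrite in_itv/= => /andP[t0 tL].
  have tl0 : 0 <= t / l by rewrite divr_ge0// ltW.
  have /andP[nt tn] := truncn_itv tl0.
  have nk : (Num.truncn (t / l) < k)%N.
    rewrite -(ltr_nat R); apply: le_lt_trans nt _.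
    by rewrite ltr_pdivrMr// kl.
  exists (Ordinal nk) => //=; rewrite in_itv/= arcE//.
  by rewrite -ler_pdivlMr// nt -ltr_pdivrMr.
- move=> i j _ _ [t /=]; rewrite !in_itv/= !arcE//.
  move=> -[/andP[it ti] /andP[jt tj]].
  have le_index (m n : nat) : m%:R * l <= t -> t < n.+1%:R * l -> (m <= n)%N.
    move=> mt tn; rewrite -ltnS -(ltr_nat R) -(ltr_pM2r l0).
    exact: le_lt_trans tn.
  by apply/val_inj/eqP; rewrite /= eqn_leq !le_index.
- by move=> i _; exists (i%:R * l) => /=; rewrite in_itv/= lexx ltrDl.
Qed.

Theorem proposition2 (R : realType) (k d : nat)
    (hk : (2 <= k)%N) (hd : (2 <= d)%N) :
  (gamma R d k <= (2 / k%:R)%R%:E)%E.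
Proof.
have k0 : (0 < k)%N by exact: ltnW.
apply: ge_ereal_sup => _ [C _ <-].
have L0 := curve_length_gt0 C; set L := curve_length C in L0 *.
have l0 : 0 < L / k%:R by rewrite divr_gt0// ltr0n.
apply: le_trans.
  apply: ereal_inf_lbound; eexists; last by reflexivity.
  exact: partition_equal_arcs.
rewrite inver gt_eqF// lee_pdivrMr// -EFinM mulrAC -mulrA.
apply: bigmax_le; first by rewrite leNye.
by move=> i _; apply: subset_length_arc_le.
Qed.
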